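(* Let $(\mathcal F,(\|\cdot\|_k)_{k\in\mathbb N})$ be a graded Fréchet space, $X\subseteq\mathcal F$ a closed subset, $y_0\in X$, $L\in\mathbb N$, and let $P$ be a contraction with $L$ loss of derivatives starting from $y_0$ (i.e. $P\in \mathrm C(X,L,y_0)$), with contraction constants $(\alpha_{kn})_{k,n\in\mathbb N}$. Then $(P^n(y_0))_{n\in\mathbb N}$ is a Cauchy sequence, and hence $$\overline y:=\lim_{n\to+\infty}P^n(y_0)\in X$$ is a fixed point of $P$. Moreover, for all $k,n\in\mathbb N$, $$\|\overline y-P^n(y_0)\|_k\le\sum_{j=n}^{+\infty}\alpha_{kj}\,\|P(y_0)-y_0\|_{k+jL}.$$
   Context: $\mathbb N=\{0,1,2,\dots\}$. A graded Fréchet space $(\mathcal F,(\|\cdot\|_k)_{k\in\mathbb N})$ is a Hausdorff, complete topological vector space whose topology is defined by an increasing sequence of seminorms: $\|\cdot\|_k\le\|\cdot\|_{k+1}$ for all $k\in\mathbb N$. Let $X$ be a closed subset of $\mathcal F$, $y_0\in X$, $L\in\mathbb N$. $P$ is a contraction with $L$ loss of derivatives starting from $y_0$, written $P\in\mathrm C(X,L,y_0)$, if: (i) $P:X\to\mathcal F$ is continuous; (ii) $P^n(y_0)\in X$ for all $n\in\mathbb N$; (iii) for all $k,n\in\mathbb N$ there exists $\alpha_{kn}\in\mathbb R_{>0}$ (the contraction constants) such that $\|P^{n+1}(y_0)-P^n(y_0)\|_k\le\alpha_{kn}\|P(y_0)-y_0\|_{k+nL}$; and (iv) (Weissinger condition)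 for all $k\in\mathbb N$, with these constants, $\sum_{n=0}^{+\infty}\alpha_{kn}\|P(y_0)-y_0\|_{k+nL}<+\infty$. *)

(* Defs.v *)
From mathcomp Require Import all_boot all_order all_algebra.
From mathcomp Require Import all_classical all_reals all_analysis.

Set Implicit Arguments.
Unset Strict Implicit.
Unset Printing Implicit Defensive.

Import Order.TTheory GRing.Theory Num.Theory.
Import numFieldNormedType.Exports.

Local Open Scope classical_set_scope.
Local Open Scope ring_scope.

Record is_seminorm (R : realType) (V : lmodType R) (p : V -> R) : Prop := {
  seminorm_ge0 : forall x, 0 <= p x ;
  seminormZ : forall (a : R) x, p (a *: x) = `|a| * p x ;
  ler_seminormD : forall x y, p (x + y) <= p x + p y }.

(* - [frechet_nbhsE]: the topology of [F] is the one defined by the family [p];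
     local convexity, which is part of [tvsType], follows from it.
   - [tvsType] relates only the topology, not the entourages, to the addition;
     [frechet_entourageE] makes [cauchy] the notion of the vector space [F].
   - completeness is not taken from [completeType], as the library has no
     structure inheriting from both [tvsType] and [completeType]. *)
Record graded_frechet (R : realType) (F : tvsType R) (p : nat -> F -> R)
    : Prop := {
  frechet_seminorm : forall k, is_seminorm (p k) ;
  frechet_graded : forall k x, p k x <= p k.+1 x ;
  frechet_nbhsE : forall (x : F) (U : set F), nbhs x U <->
    exists n, exists2 e : R, 0 < e &
      [set y | forall k, (k <= n)%N -> p k (y - x) < e] `<=` U ;
  frechet_entourageE : forall A : set (F * F), entourage A <->
    exists2 U : set F, nbhs (0 : F) U & [set xy | U (xy.1 - xy.2)] `<=` A ;
  frechet_hausdorff : hausdorff_space F ;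
  frechet_complete : forall G : set_system F,
    ProperFilter G -> cauchy G -> exists x : F, G --> x }.

(* [P] stands for a map [X -> F]: its values outside [X] are irrelevant, since
   [loss_iter] keeps the iterates in [X]. *)
Record loss_contraction (R : realType) (F : tvsType R) (p : nat -> F -> R)
    (X : set F) (L : nat) (y0 : F) (P : F -> F) (alpha : nat -> nat -> R)
    : Prop := {
  loss_continuous : {within X, continuous P} ;
  loss_iter : forall n, X (iter n P y0) ;
  loss_const_gt0 : forall k n, 0 < alpha k n ;
  loss_contract : forall k n,
    p k (iter n.+1 P y0 - iter n P y0)
      <= alpha k n * p (k + n * L)%N (P y0 - y0) ;
  loss_weissinger : forall k,
    (\sum_(0 <= n <oo) (alpha k n * p (k + n * L)%N (P y0 - y0))%:E < +oo)%E }.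

(* Main.v *)
(* Telescoping bounds p_k (P^m y0 - P^n y0), for n <= m, by the tail from n of
   the Weissinger series of index k. The loss of derivatives therefore plays no
   role once that series converges: the tails tend to 0, which gives the Cauchy
   property, and letting m tend to infinity gives the estimate at the limit. *)

Require Import Defs.
From mathcomp Require Import all_boot all_order all_algebra.
From mathcomp Require Import all_classical all_reals all_analysis.

Set Implicit Arguments.
Unset Strict Implicit.
Unset Printing Implicit Defensive.

Import Order.TTheory GRing.Theory Num.Theory.
Import numFieldNormedType.Exports.
Local Open Scope classical_set_scope.
Local Open Scope ring_scope.

Lemma seminorm0 (R : realType) (V : lmodType R) (q : V -> R) :
  is_seminorm q -> q 0 = 0.
Proof. by move=> hq; have := seminormZ hq 0 0; rewrite scale0r normr0 mul0r. Qed.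

Lemma seminorm_distC (R : realType) (V : lmodType R) (q : V -> R) (x y : V) :
  is_seminorm q -> q (x - y) = q (y - x).
Proof.
move=> hq; have := seminormZ hq (-1) (y - x).
by rewrite scaleN1r opprB normrN1 mul1r.
Qed.

Lemma ler_seminorm_distD (R : realType) (V : lmodType R) (q : V -> R)
    (z x y : V) :
  is_seminorm q -> q (x - y) <= q (x - z) + q (z - y).
Proof.
move=> hq; have -> : x - y = (x - z) + (z - y) by rewrite addrA subrK.
exact: ler_seminormD.
Qed.

Lemma seminorm_telescope (R : realType) (V : lmodType R) (q : V -> R)
    (u : nat -> V) (b : nat -> R) (n m : nat) :
  is_seminorm q -> (forall j, q (u j.+1 - u j) <= b j) -> (n <= m)%N ->
  q (u m - u n) <= \sum_(n <= j < m) b j.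
Proof.
move=> hq hb; elim: m => [|m IHm].
  by rewrite leqn0 => /eqP ->; rewrite subrr seminorm0 // big_geq.
rewrite leq_eqVlt => /predU1P[->|]; first by rewrite subrr seminorm0 // big_geq.
rewrite ltnS => nm; rewrite big_nat_recr //= addrC.
exact: le_trans (ler_seminorm_distD (u m) _ _ hq) (lerD (hb m) (IHm nm)).
Qed.

(** Each [b j] dominates a value of the seminorm and is thus nonnegative, so the finite telescoping
    sum is at most the whole tail, a bound that does not depend on [m]. *)
Lemma seminorm_telescope_tail (R : realType) (V : lmodType R) (q : V -> R)
    (u : nat -> V) (b : nat -> R) (n m : nat) :
  is_seminorm q -> (forall j, q (u j.+1 - u j) <= b j) -> (n <= m)%N ->
  ((q (u m - u n))%:E <= \sum_(n <= j <oo) (b j)%:E)%E.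
Proof.
move=> hq hb nm.
have b_ge0 j : 0 <= b j by apply: le_trans (hb j); exact: seminorm_ge0.
apply: le_trans (nneseries_lim_ge m _) => [|j _ _]; last by rewrite lee_fin.
by rewrite sumEFin lee_fin (seminorm_telescope hq hb nm).
Qed.

Lemma nneseries_tail_lt (R : realType) (b : nat -> R) (e : R) :
  (forall j, 0 <= b j) -> (\sum_(0 <= j <oo) (b j)%:E < +oo)%E -> 0 < e ->
  \forall n \near \oo, (\sum_(n <= j <oo) (b j)%:E < e%:E)%E.
Proof.
move=> b_ge0 bfin e_gt0.
have b_ge0E j : true -> (0 <= (b j)%:E)%E by rewrite lee_fin.
(* The tails tend to 0, and the open ray below [e] is a neighbourhood of 0. *)
apply: (nneseries_tail_cvg bfin b_ge0E (t := [set x | (x < e%:E)%E])).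
by apply: open_nbhs_nbhs; split; [exact: open_ereal_lt_ereal|rewrite /= lte_fin].
Qed.

Lemma frechet_graded_le (R : realType) (F : tvsType R) (p : nat -> F -> R)
    (k n : nat) (x : F) :
  graded_frechet p -> (k <= n)%N -> p k x <= p n x.
Proof.
move=> hp; apply: (@homo_leq _ (p ^~ x) (fun a b => a <= b)) => //.
- by move=> ? ? ?; exact: le_trans.
- by move=> ?; exact: frechet_graded.
Qed.

Lemma frechet_cvg_seminorm (R : realType) (F : tvsType R) (p : nat -> F -> R)
    (u : nat -> F) (l : F) (k : nat) (e : R) :
  graded_frechet p -> u n @[n --> \oo] --> l -> 0 < e ->
  \forall n \near \oo, p k (u n - l) < e.
Proof.
move=> hp ul e_gt0; apply: (ul [set y | p k (y - l) < e]).
by apply/(frechet_nbhsE hp); exists k, e => // y /(_ k (leqnn k)).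
Qed.

(** Since the seminorms increase, every neighbourhood of 0 contains a ball of a single [p k]. Two
    late terms are then compared through [u N], at a cost of [e / 2] each. *)
Lemma frechet_cauchy_seq (R : realType) (F : tvsType R) (p : nat -> F -> R)
    (u : nat -> F) :
  graded_frechet p ->
  (forall k (e : R), 0 < e ->
    exists N, forall m, (N <= m)%N -> p k (u m - u N) < e) ->
  cauchy (u n @[n --> \oo]).
Proof.
move=> hp hu A /(frechet_entourageE hp)[U /(frechet_nbhsE hp)[k [e e_gt0 eU]] UA].
have [N hN] := hu k (e / 2) (divr_gt0 e_gt0 (ltr0n _ 2)).
exists (u @` [set n | (N <= n)%N], u @` [set n | (N <= n)%N]).
  by split; exists N => // n Nn; exists n.
move=> [_ _] /= [[m Nm <-] [n Nn <-]]; apply: UA => /=; apply: eU => j jk /=.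
(* The basic neighbourhood constrains all [p j] with [j <= k]; the grading reduces them to [p k]. *)
rewrite subr0; apply: le_lt_trans (frechet_graded_le _ hp jk) _.
have hk := frechet_seminorm hp k.
apply: le_lt_trans (ler_seminorm_distD (u N) _ _ hk) _.
by rewrite (splitr e) ltrD // ?[p k (u N - _)]seminorm_distC //; apply: hN.
Qed.

(** The sequence of the [f (iter n f x)] tends to [f l] by continuity, and to [l] because it is the
    shifted sequence of iterates; limits are unique. *)
Lemma cvg_iter_fixpoint (T : topologicalType) (X : set T) (f : T -> T)
    (x l : T) :
  hausdorff_space T -> X l -> {within X, continuous f} ->
  (forall n, X (iter n f x)) -> iter n f x @[n --> \oo] --> l -> f l = l.
Proof.
move=> T2 Xl /subspace_continuousP fX Xf xl.
have flim : f (iter n f x) @[n --> \oo] --> f l.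
  (* Continuity at [l] only concerns points of [X]; [Xf n] places the iterates there. *)
  by move=> A /(fX _ Xl)/xl [N _ NA]; exists N => // n Nn; exact: NA n Nn (Xf n).
apply: (cvg_unique T2 flim) => A /xl [N _ NA].
by exists N => // n Nn; apply: (NA n.+1); exact: leqW.
Qed.

Theorem theorem4 (R : realType) (F : tvsType R) (p : nat -> F -> R)
    (X : set F) (y0 : F) (L : nat) (P : F -> F) (alpha : nat -> nat -> R) :
  graded_frechet p -> closed X -> X y0 ->
  loss_contraction p X L y0 P alpha ->
  cauchy (iter n P y0 @[n --> \oo]) /\
  exists ybar : F,
    [/\ iter n P y0 @[n --> \oo] --> ybar,
        X ybar,
        P ybar = ybar &
        forall k n : nat,
          ((p k (ybar - iter n P y0))%:E <=
             \sum_(n <= j <oo)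
               (alpha k j * p (k + j * L)%N (P y0 - y0))%:E)%E].
Proof.
move=> hp Xcl _ hP; set u := fun n => iter n P y0.
have hk k := frechet_seminorm hp k.
have tail k n m : (n <= m)%N -> ((p k (u m - u n))%:E <=
    \sum_(n <= j <oo) (alpha k j * p (k + j * L)%N (P y0 - y0))%:E)%E.
  by apply: seminorm_telescope_tail => // j; exact: (loss_contract hP k j).
have uC : cauchy (u n @[n --> \oo]).
  apply: (frechet_cauchy_seq hp) => k e e_gt0.
  (* The rank [N] at which the tail falls below [e] also serves as the reference index, since that
     tail bounds [p k (u m - u N)] for all [m >= N]. *)
  have [|N _ /(_ N (leqnn N)) Ne] :=
      nneseries_tail_lt _ (loss_weissinger hP k) e_gt0.
    by move=> j; rewrite mulr_ge0 ?(ltW (loss_const_gt0 hP _ _)) ?seminorm_ge0.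
  by exists N => m Nm; rewrite -lte_fin; apply: le_lt_trans (tail k _ _ Nm) Ne.
split=> //; have [l ul] := frechet_complete hp _ uC.
have Xl : X l.
  by apply: closed_cvg ul => //; apply: nearW => n; exact: (loss_iter hP n).
exists l; split=> // [|k n].
  exact: cvg_iter_fixpoint (frechet_hausdorff hp) Xl (loss_continuous hP)
    (loss_iter hP) ul.
(* The passage to the limit is done by proving the bound up to an arbitrary [e > 0]. *)
apply/lee_addgt0Pr => e e_gt0.
have [N _ Ne] := frechet_cvg_seminorm k hp ul e_gt0.
(* The intermediate index must be at least [N], to be within [e] of [l], and at least [n], for the
   tail bound to apply. *)
have := ler_seminorm_distD (u (maxn N n)) l (u n) (hk k).
rewrite -lee_fin EFinD addeC => /le_trans; apply; apply: leeD.
  by apply: tail; exact: leq_maxr.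
by rewrite lee_fin seminorm_distC //; apply/ltW/Ne; exact: leq_maxl.
Qed.
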